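(* Let $X\subset\mathbb{R}^n$ be open, let $\mathcal{G}$ be either $\mathcal{J}^2(X)$ or a subequation $\mathcal{G}\subsetneq\mathcal{J}^2(X)$, and let $F\in C(\mathcal{G})$ be proper elliptic. Suppose that $$\mathcal{F}:=\{(x,J)\in\mathcal{G}:F(x,J)\ge0\}$$ is a subequation, and that compatibility holds: $$\operatorname{int}\mathcal{F}=\{(x,J)\in\mathcal{G}:F(x,J)>0\}.$$ Then the correspondence principle holds: for every $u\in\mathrm{USC}(X)$, $$u\text{ is }\mathcal{F}\text{-subharmonic on }X\iff u\text{ is a }\mathcal{G}\text{-admissible viscosity subsolution of }F(J^2u)=0\text{ on }X,$$ and for every $u\in\mathrm{LSC}(X)$, $$u\text{ is }\mathcal{F}\text{-superharmonic on }X\iff u\text{ is a }\mathcal{G}\text{-admissible viscosity supersolution of }F(J^2u)=0\text{ on }X.$$ In particular, $u\in C(X)$ is a $\mathcal{G}$-admissible viscosity solution of $F(J^2u)=0$ in $X$ if and only if $u$ is $\mathcal{F}$-harmonic in $X$.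
   Context: $\mathcal{S}(n)$ is the space of real symmetric $n\times n$ matrices with its usual partial order; $\mathcal{J}^2=\mathbb{R}\times\mathbb{R}^n\times\mathcal{S}(n)$; $\mathcal{J}^2(X)=X\times\mathcal{J}^2$, and for $\mathcal{F}\subset\mathcal{J}^2(X)$, $\mathcal{F}_x=\{J:(x,J)\in\mathcal{F}\}$. $\mathrm{USC}$ (resp. $\mathrm{LSC}$) denotes upper (lower) semicontinuous functions with values in $[-\infty,+\infty)$ (resp. $(-\infty,+\infty]$). Subequation: $\mathcal{F}\subset\mathcal{J}^2(X)$ is a subequation on $X$ if for all $x\in X$: (P) $(r,p,A)\in\mathcal{F}_x\Rightarrow(r,p,A+P)\in\mathcal{F}_x$ for all $P\ge0$; (N) $(r,p,A)\in\mathcal{F}_x\Rightarrow(r+s,p,A)\in\mathcal{F}_x$ for all $s\le0$; (T) $\mathcal{F}=\overline{\operatorname{int}\mathcal{F}}$, $\mathcal{F}_x=\overline{\operatorname{int}(\mathcal{F}_x)}$ and $(\operatorname{int}\mathcal{F})_x=\operatorname{int}(\mathcal{F}_x)$. Proper elliptic: $F(x,r,p,A)\le F(x,r+s,p,A+P)$ for all $x\in X$, $(r,p,A)\in\mathcal{G}_x$, $s\le0$ in $\mathbb{R}$ and $P\ge0$ in $\mathcal{S}(n)$. Test jets: $J^{2,+}_xu$ (resp. $J^{2,-}_xu$) is the set of $(\varphi(x),D\varphi(x),D^2\varphi(x))$ with $\varphi$ of class $C^2$ near $x$ and $u\le\varphi$ (resp. $u\ge\varphi$) near $x$ with equality at $x$.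 $u\in\mathrm{USC}(X)$ is $\mathcal{F}$-subharmonic if $J^{2,+}_xu\subset\mathcal{F}_x$ for all $x\in X$. The Dirichlet dual is $\widetilde{\mathcal{F}}=(-\operatorname{int}\mathcal{F})^c$, with fibers $\widetilde{\mathcal{F}}_x=(-\operatorname{int}\mathcal{F}_x)^c$. $u\in\mathrm{LSC}(X)$ is $\mathcal{F}$-superharmonic if $-u$ is $\widetilde{\mathcal{F}}$-subharmonic, i.e. $J^{2,+}_x(-u)\subset\widetilde{\mathcal{F}}_x$ for all $x\in X$. $u\in C(X)$ is $\mathcal{F}$-harmonic if it is both $\mathcal{F}$-subharmonic and $\mathcal{F}$-superharmonic. $u\in\mathrm{USC}(X)$ is a $\mathcal{G}$-admissible viscosity subsolution of $F(J^2u)=0$ on $X$ if for every $x\in X$ and $J\in J^{2,+}_xu$ one has $J\in\mathcal{G}_x$ and $F(x,J)\ge0$. $u\in\mathrm{LSC}(X)$ is a $\mathcal{G}$-admissible viscosity supersolution if for every $x\in X$ and $J\in J^{2,-}_xu$, either $J\in\mathcal{G}_x$ and $F(x,J)\le0$, or $J\notin\mathcal{G}_x$. $u\in C(X)$ is a $\mathcal{G}$-admissible viscosity solution if it is both. *)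

(* Defs.v *)
From HB Require Import structures.
From mathcomp Require Import all_boot all_order all_algebra.
From mathcomp Require Import all_classical all_reals all_analysis.

Set Implicit Arguments.
Unset Strict Implicit.
Unset Printing Implicit Defensive.

Import Order.TTheory GRing.Theory Num.Theory.
Import numFieldNormedType.Exports.

Local Open Scope classical_set_scope.
Local Open Scope ring_scope.

(* S(n) is a type of its own, rather than a set of matrices, because interiors
   and closures of sets of 2-jets are taken relative to R x R^n x S(n). *)
Definition symmetric_pred (R : realType) (n : nat) : {pred 'M[R]_n} :=
  fun A => A^T == A.

Lemma symmetric_zmod_closed (R : realType) (n : nat) :
  zmod_closed (@symmetric_pred R n).
Proof.
split; first by rewrite unfold_in /= trmx0.
move=> A B; rewrite !unfold_in /= => /eqP hA /eqP hB.
by rewrite linearB /= hA hB.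
Qed.

HB.instance Definition _ (R : realType) (n : nat) :=
  GRing.isZmodClosed.Build 'M[R]_n (@symmetric_pred R n)
    (@symmetric_zmod_closed R n).

Record symmx (R : realType) (n : nat) := SymMx {
  mx_of_symmx :> 'M[R]_n;
  symmxP : mx_of_symmx \in @symmetric_pred R n }.

HB.instance Definition _ (R : realType) (n : nat) :=
  [isSub for @mx_of_symmx R n].
HB.instance Definition _ (R : realType) (n : nat) :=
  [Choice of symmx R n by <:].
HB.instance Definition _ (R : realType) (n : nat) :=
  [SubChoice_isSubZmodule of symmx R n by <:].
HB.instance Definition _ (R : realType) (n : nat) :=
  Topological.copy (symmx R n) (initial_topology (@mx_of_symmx R n)).

Definition psd (R : realType) (n : nat) (P : symmx R n) : Prop :=
  forall v : 'rV[R]_n, 0 <= (v *m P *m v^T) 0 0.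

(* An element of [jet2 R n] is [(r, p, A)]; an element of [jet2_bundle R n] is
   [(x, J)], where [x] ranges over the whole of R^n. *)
Notation jet2 R n := (R * 'rV[R]_n * symmx R n)%type.
Notation jet2_bundle R n := ('rV[R]_n * jet2 R n)%type.

Definition J2 (R : realType) (n : nat) (X : set 'rV[R]_n) :
    set (jet2_bundle R n) :=
  [set w | X w.1].

Definition fiber (R : realType) (n : nat) (F : set (jet2_bundle R n))
    (x : 'rV[R]_n) : set (jet2 R n) :=
  [set J | F (x, J)].

(* For X open, the interior relative to J^2(X) is the interior in the ambient
   space; the closure relative to J^2(X) is the ambient closure cut by J^2(X).
   The three equations of (T) are the last three clauses. *)
Definition subequation (R : realType) (n : nat) (X : set 'rV[R]_n)
    (F : set (jet2_bundle R n)) : Prop :=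
  F `<=` J2 X /\
  (forall x, X x ->
    (forall (r : R) (p : 'rV[R]_n) (A P : symmx R n), fiber F x (r, p, A) -> psd P ->
      fiber F x (r, p, A + P)) /\
    (forall (r s : R) (p : 'rV[R]_n) (A : symmx R n), fiber F x (r, p, A) -> s <= 0 ->
      fiber F x (r + s, p, A))) /\
  [/\ F = closure F° `&` J2 X,
      (forall x, X x -> fiber F x = closure (fiber F x)°) &
      (forall x, X x -> fiber (F°) x = (fiber F x)°)].

Definition dirichlet_dual (R : realType) (n : nat) (X : set 'rV[R]_n)
    (F : set (jet2_bundle R n)) : set (jet2_bundle R n) :=
  J2 X `\` [set (w.1, - w.2) | w in F°].

Definition proper_elliptic (R : realType) (n : nat) (X : set 'rV[R]_n)
    (G : set (jet2_bundle R n)) (F : jet2_bundle R n -> R) : Prop :=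
  forall x (r : R) (p : 'rV[R]_n) (A : symmx R n), X x -> fiber G x (r, p, A) ->
  forall (s : R) (P : symmx R n), s <= 0 -> psd P ->
  F (x, (r, p, A)) <= F (x, (r + s, p, A + P)).

(* LSC(X) and USC(X); [u] is irrelevant outside X, since the points of the
   complement of X are isolated in [subspace X]. *)
Definition lsc (R : realType) (n : nat) (X : set 'rV[R]_n)
    (u : 'rV[R]_n -> \bar R) : Prop :=
  (forall x, X x -> u x != -oo%E) /\
  lower_semicontinuous (u : subspace X -> \bar R).

Definition usc (R : realType) (n : nat) (X : set 'rV[R]_n)
    (u : 'rV[R]_n -> \bar R) : Prop :=
  lsc X (fun x => - u x)%E.

Definition partial (R : realType) (n : nat) (i : 'I_n)
    (phi : 'rV[R]_n -> R) : 'rV[R]_n -> R :=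
  fun x => 'D_(delta_mx 0 i) phi x.

Definition C2_near (R : realType) (n : nat) (phi : 'rV[R]_n -> R)
    (x : 'rV[R]_n) : Prop :=
  \forall y \near x,
    [/\ {for y, continuous phi},
        (forall i : 'I_n, derivable phi y (delta_mx 0 i) /\
                   {for y, continuous (partial i phi)}) &
        (forall i j : 'I_n, derivable (partial i phi) y (delta_mx 0 j) /\
                     {for y, continuous (partial j (partial i phi))})].

Definition gradient (R : realType) (n : nat) (phi : 'rV[R]_n -> R)
    (x : 'rV[R]_n) : 'rV[R]_n :=
  \row_i partial i phi x.

Definition hessian (R : realType) (n : nat) (phi : 'rV[R]_n -> R)
    (x : 'rV[R]_n) : 'M[R]_n :=
  \matrix_(i, j) partial j (partial i phi) x.

Definition has_jet2 (R : realType) (n : nat) (phi : 'rV[R]_n -> R)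
    (x : 'rV[R]_n) (J : jet2 R n) : Prop :=
  [/\ J.1.1 = phi x, J.1.2 = gradient phi x &
      J.2 = hessian phi x :> 'M[R]_n].

Definition upper_jets (R : realType) (n : nat) (u : 'rV[R]_n -> \bar R)
    (x : 'rV[R]_n) : set (jet2 R n) :=
  [set J | exists phi : 'rV[R]_n -> R,
    [/\ C2_near phi x,
        (\forall y \near x, (u y <= (phi y)%:E)%E),
        u x = (phi x)%:E &
        has_jet2 phi x J]].

Definition lower_jets (R : realType) (n : nat) (u : 'rV[R]_n -> \bar R)
    (x : 'rV[R]_n) : set (jet2 R n) :=
  [set J | exists phi : 'rV[R]_n -> R,
    [/\ C2_near phi x,
        (\forall y \near x, ((phi y)%:E <= u y)%E),
        u x = (phi x)%:E &
        has_jet2 phi x J]].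

Definition F_subharmonic (R : realType) (n : nat) (X : set 'rV[R]_n)
    (F : set (jet2_bundle R n)) (u : 'rV[R]_n -> \bar R) : Prop :=
  usc X u /\ forall x, X x -> upper_jets u x `<=` fiber F x.

Definition F_superharmonic (R : realType) (n : nat) (X : set 'rV[R]_n)
    (F : set (jet2_bundle R n)) (u : 'rV[R]_n -> \bar R) : Prop :=
  lsc X u /\ F_subharmonic X (dirichlet_dual X F) (fun x => - u x)%E.

Definition F_harmonic (R : realType) (n : nat) (X : set 'rV[R]_n)
    (F : set (jet2_bundle R n)) (u : 'rV[R]_n -> R) : Prop :=
  [/\ {within X, continuous u}, F_subharmonic X F (EFin \o u) &
      F_superharmonic X F (EFin \o u)].

Definition viscosity_subsolution (R : realType) (n : nat) (X : set 'rV[R]_n)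
    (G : set (jet2_bundle R n)) (F : jet2_bundle R n -> R)
    (u : 'rV[R]_n -> \bar R) : Prop :=
  usc X u /\
  forall x, X x -> forall J, upper_jets u x J -> fiber G x J /\ 0 <= F (x, J).

Definition viscosity_supersolution (R : realType) (n : nat) (X : set 'rV[R]_n)
    (G : set (jet2_bundle R n)) (F : jet2_bundle R n -> R)
    (u : 'rV[R]_n -> \bar R) : Prop :=
  lsc X u /\
  forall x, X x -> forall J, lower_jets u x J ->
    (fiber G x J /\ F (x, J) <= 0) \/ ~ fiber G x J.

Definition viscosity_solution (R : realType) (n : nat) (X : set 'rV[R]_n)
    (G : set (jet2_bundle R n)) (F : jet2_bundle R n -> R)
    (u : 'rV[R]_n -> R) : Prop :=
  [/\ {within X, continuous u}, viscosity_subsolution X G F (EFin \o u) &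
      viscosity_supersolution X G F (EFin \o u)].

Definition constraint_set (R : realType) (n : nat)
    (G : set (jet2_bundle R n)) (F : jet2_bundle R n -> R) :
    set (jet2_bundle R n) :=
  [set w | G w /\ 0 <= F w].

(* Main.v *)
Require Import Defs.
From mathcomp Require Import all_boot all_order all_algebra.
From mathcomp Require Import all_classical all_reals all_analysis.

Import Order.TTheory GRing.Theory Num.Theory.
Import numFieldNormedType.Exports.

Local Open Scope classical_set_scope.
Local Open Scope ring_scope.

(** The subsolution half only unfolds the constraint set
    [{F >= 0}]: a test jet from above lies in it exactly when it is admissible
    and satisfies [F >= 0].

    The supersolution half is a statement about complements.  If [phi] touches
    [u] from below, then [- phi] touches [- u] from above, so the lower jets of
    [u] are the opposites of the upper jets of [- u] ([lower_jetsP]).  The dual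
    is the complement of the reflected interior, so it contains [- J] exactly
    when [J] is not interior to the constraint set ([fiber_dirichlet_dual]).
    Hence [u] is superharmonic iff none of its lower jets is an interior jet.
    Compatibility identifies the interior with [{F > 0}], and the negation of
    [J in G and F (x, J) > 0] is precisely the supersolution alternative:
    either [J] is not admissible, or [F (x, J) <= 0].

    The two halves together give the equivalence for continuous functions. *)

(** Where [phi] has no directional derivative, neither has [- phi], and both
    limits then take the default value [0], so the identity holds everywhere;
    being an equality of functions, it can be applied twice to reach second
    derivatives. *)
Lemma partialN {R : realType} {n : nat} (i : 'I_n) (phi : 'rV[R]_n -> R) :
  partial i (- phi) = - partial i phi.
Proof.
apply/funext => x; rewrite /partial -[RHS]/(- 'D_(delta_mx 0 i) phi x).
have [dphi|ndphi] := pselect (derivable phi x (delta_mx 0 i)).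
  exact: deriveN.
have ndNphi : ~ derivable (- phi) x (delta_mx 0 i).
  by move=> /derivableN; rewrite opprK.
by rewrite /derive (dvgP ndphi) (dvgP ndNphi) oppr0.
Qed.

Lemma C2_nearN {R : realType} {n : nat} (phi : 'rV[R]_n -> R) (x : 'rV[R]_n) :
  C2_near phi x -> C2_near (- phi) x.
Proof.
apply: filterS => y [cphi dphi ddphi]; split.
- exact: continuousN.
- move=> i; have [d c] := dphi i; rewrite partialN.
  by split; [exact: derivableN|exact: continuousN].
- move=> i j; have [d c] := ddphi i j; rewrite !partialN.
  by split; [exact: derivableN|exact: continuousN].
Qed.

Lemma has_jet2N {R : realType} {n : nat} (phi : 'rV[R]_n -> R) (x : 'rV[R]_n)
    (J : jet2 R n) :
  has_jet2 phi x J -> has_jet2 (- phi) x (- J).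
Proof.
case: J => [[r p] A] [/= -> -> hA]; split => //=.
- by apply/rowP => i; rewrite !mxE partialN.
- by rewrite /= hA; apply/matrixP => i j; rewrite !mxE !partialN.
Qed.

(** [phi] is a lower test function for [u] iff [- phi] is an upper test function
    for [- u]; this turns the dual condition on [- u] into one on [u]. *)
Lemma lower_jetsP {R : realType} {n : nat} {u : 'rV[R]_n -> \bar R}
    {x : 'rV[R]_n} {J : jet2 R n} :
  lower_jets u x J <-> upper_jets (fun y => - u y)%E x (- J).
Proof.
split=> -[phi [phiC2 le_u ux phiJ]]; exists (- phi); split.
- exact: C2_nearN.
- by apply: filterS le_u => y; rewrite fctE EFinN leeN2.
- by rewrite ux.
- exact: has_jet2N.
- exact: C2_nearN.
- by apply: filterS le_u => y; rewrite fctE EFinN leeNl.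
- by rewrite -[u x]oppeK ux.
- by rewrite -[J]opprK; exact: has_jet2N.
Qed.

Lemma fiber_dirichlet_dual {R : realType} {n : nat} {X : set 'rV[R]_n}
    {F : set (jet2_bundle R n)} {x : 'rV[R]_n} {J : jet2 R n} :
  X x -> fiber (dirichlet_dual X F) x (- J) <-> ~ F° (x, J).
Proof.
move=> Xx; split.
- by move=> [_ nF] FJ; apply: nF; exists (x, J).
- move=> nF; split=> // -[[y K] FK] /pair_equal_spec[/= xy /oppr_inj KJ].
  by apply: nF; rewrite -xy -KJ.
Qed.

Theorem theorem7p4 (R : realType) (n : nat) (X : set 'rV[R]_n)
  (G : set (jet2_bundle R n)) (F : jet2_bundle R n -> R)
  (X_open : open X)
  (G_cases : G = J2 X \/ (subequation X G /\ G `<` J2 X))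
  (F_cont : {within G, continuous F})
  (F_proper : proper_elliptic X G F)
  (F_subeq : subequation X (constraint_set G F))
  (compatibility : (constraint_set G F)° = [set w | G w /\ 0 < F w]) :
  [/\ (forall u : 'rV[R]_n -> \bar R, usc X u ->
        (F_subharmonic X (constraint_set G F) u <->
         viscosity_subsolution X G F u)),
      (forall u : 'rV[R]_n -> \bar R, lsc X u ->
        (F_superharmonic X (constraint_set G F) u <->
         viscosity_supersolution X G F u)) &
      (forall u : 'rV[R]_n -> R, {within X, continuous u} ->
        (viscosity_solution X G F u <->
         F_harmonic X (constraint_set G F) u))].
Proof.
have subE (u : 'rV[R]_n -> \bar R) :
    F_subharmonic X (constraint_set G F) u <-> viscosity_subsolution X G F u.
  by [].
have superE (u : 'rV[R]_n -> \bar R) :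
    F_superharmonic X (constraint_set G F) u <->
    viscosity_supersolution X G F u.
  split=> [[lscu [_ jets_u]]|[lscu jets_u]]; split=> //.
  - move=> x Xx J /lower_jetsP/(jets_u x Xx)/(fiber_dirichlet_dual Xx).
    rewrite compatibility /= => nFJ.
    have [GJ|] := pselect (fiber G x J); [left|by right].
    by split=> //; rewrite leNgt; apply/negP => FJ; exact: nFJ.
  - split=> [|x Xx J].
      rewrite /usc; suff -> : (fun x => - - u x)%E = u by [].
      by apply/funext => x; rewrite oppeK.
    rewrite -[J]opprK => /lower_jetsP/(jets_u x Xx) GFJ.
    apply/(fiber_dirichlet_dual Xx); rewrite compatibility /= => -[GJ FJ].
    by case: GFJ => [[_]|//]; rewrite leNgt FJ.
split=> [u _|u _|u _]; [exact: subE|exact: superE|].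
by split=> -[cu /subE su /superE pu].
Qed.
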